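(* Let $A$ be an algebra in a Mal'cev variety, and let $\mathcal U,\mathcal V\in\operatorname{Unif} A$ be compatible uniformities on $A$. Then $\mathcal U$ and $\mathcal V$ permute.
   Context: A Mal'cev variety is a variety of algebras having a ternary term $p$ satisfying the identities $p(x,x,y)=p(y,x,x)=y$. A uniformity on a set $S$ is a filter $\mathcal U$ of reflexive binary relations on $S$ such that $U\in\mathcal U$ implies $U^{-1}\in\mathcal U$, and for every $U\in\mathcal U$ there is $V\in\mathcal U$ with $V\circ V\subseteq U$. A uniformity on the underlying set of an algebra $A$ is compatible if all basic operations of $A$ are uniformly continuous; $\operatorname{Unif} A$ is the set of compatible uniformities. For relations, $U\circ V=\{\langle u,v\rangle\mid \exists w\; u\mathrel U w\mathrel V v\}$; for sets of relations, $\mathcal U\circ\mathcal V=\{U\circ V\mid U\in\mathcal U, V\in\mathcal V\}$; $\operatorname{Fg}$ denotes the generated filter of binary relations. Uniformities $\mathcal U,\mathcal V$ permute if $\operatorname{Fg}(\mathcal U\circ\mathcal V)=\operatorname{Fg}(\mathcal V\circ\mathcal U)$; equivalently, for every $U\in\mathcal U$, $V\in\mathcal V$ there exist $\bar U,\hat U\in\mathcal U$, $\bar V,\hat V\in\mathcal V$ with $\bar V\circ\bar U\subseteq U\circ V$ and $\hat U\circ\hat V\subseteq V\circ U$. *)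

(* Defs.v *)
From mathcomp Require Import all_boot.
From mathcomp Require Import boolp classical_sets filter.

Set Implicit Arguments.
Unset Strict Implicit.
Unset Printing Implicit Defensive.

Local Open Scope classical_set_scope.
Local Open Scope relation_scope.

Record signature := Signature { op : Type; arity : op -> nat }.

Record algebra (S : signature) := Algebra {
  carrier :> Type;
  interp : forall o : op S, ('I_(arity o) -> carrier) -> carrier }.

Inductive term (S : signature) (X : Type) :=
  | Var of X
  | App (o : op S) of 'I_(arity o) -> term S X.

Arguments Var {S X}.
Arguments App {S X}.

Fixpoint eval (S : signature) (A : algebra S) (X : Type) (env : X -> A)
    (t : term S X) : A :=
  match t with
  | Var x => env x
  | App o args => interp (fun i => eval env (args i))
  end.

Definition identity (S : signature) := (term S nat * term S nat)%type.

Definition satisfies (S : signature) (A : algebra S) (e : identity S) :=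
  forall env : nat -> A, eval env e.1 = eval env e.2.

Definition is_variety (S : signature) (K : algebra S -> Prop) :=
  exists E : set (identity S),
    forall A, K A <-> (forall e, E e -> satisfies A e).

Definition eval3 (S : signature) (A : algebra S) (p : term S 'I_3)
    (x y z : A) : A :=
  eval (tnth [tuple x; y; z]) p.

Definition is_malcev_variety (S : signature) (K : algebra S -> Prop) :=
  is_variety K /\
  exists p : term S 'I_3, forall A, K A ->
    forall x y : A, eval3 p x x y = y /\ eval3 p y x x = y.

(* The axioms of the structure [uniformType], for a uniformity given as a
   variable: an algebra carries several uniformities, so none of them can be
   the canonical one.  [Filter] does not require properness: the empty relation
   is reflexive on the empty set. *)
Record is_uniformity (T : Type) (U : set_system (T * T)) : Prop := {
  uniformity_filter : Filter U;
  uniformity_refl : forall R, U R -> diagonal `<=` R;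
  uniformity_inv : forall R, U R -> U R^-1;
  uniformity_split : forall R, U R -> exists2 R', U R' & R' \; R' `<=` R }.

Definition power_uniformity (T : Type) (n : nat) (U : set_system (T * T)) :
    set_system (('I_n -> T) * ('I_n -> T)) :=
  filter_from [set R : 'I_n -> set (T * T) | forall i, U (R i)]
    (fun R => [set ab | forall i, R i (ab.1 i, ab.2 i)]).

Definition uniformly_continuous (T T' : Type) (U : set_system (T * T))
    (U' : set_system (T' * T')) (f : T -> T') :=
  (fun xy => (f xy.1, f xy.2)) @ U --> U'.

Definition Unif (S : signature) (A : algebra S) : set (set_system (A * A)) :=
  [set U | is_uniformity U /\
    forall o : op S,
      uniformly_continuous (power_uniformity (n := arity o) U) U
        (@interp S A o)].

Arguments Unif {S} A.

(* The library notation [\;] composes in the reverse order: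
   [rel_comp R R'] relates [u] to [v] iff [R (u, w)] and [R' (w, v)]
   for some [w]. *)
Definition rel_comp (T : Type) (R R' : set (T * T)) : set (T * T) := R' \; R.

Definition system_comp (T : Type) (U V : set_system (T * T)) :
    set_system (T * T) :=
  [set rel_comp R R' | R in U & R' in V].

Definition Fg (T : Type) (G : set_system (T * T)) : set_system (T * T) :=
  smallest Filter G.

Definition permute (T : Type) (U V : set_system (T * T)) :=
  Fg (system_comp U V) = Fg (system_comp V U).

(* Main.v *)
Require Import Defs.
From mathcomp Require Import all_boot.
From mathcomp Require Import boolp classical_sets filter.

(** If [u] is [V]-close to [w] and [w] is [U]-close to [v], then the Mal'cev
    term gives the midpoint [m = p(u, w, v)]: it is [U]-close to
    [p(u, w, w) = u] and [V]-close to [p(w, w, v) = v], because term operations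
    are uniformly continuous for every compatible uniformity. *)

Local Open Scope classical_set_scope.
Local Open Scope relation_scope.

(** Induction on [t]. A single [Q] serves all variables, even for infinite [X], because arities are
    finite and so each node only intersects finitely many entourages. *)
Lemma eval_uniformly_continuous (S : signature) (A : algebra S)
    (U : set_system (A * A)) (hU : Unif A U) (X : Type) (t : term S X)
    (R : set (A * A)) (UR : U R) :
  exists2 Q, U Q & forall env env' : X -> A,
    (forall x, Q (env x, env' x)) -> R (eval env t, eval env' t).
Proof.
have [[filterU _ _ _] contU] := hU.
elim: t R UR => [x|o args IH] R UR.
  by exists R => // env env' Renv; exact: Renv.
have [P UP PR] := contU o R UR.
(* Choosing the entourage of each argument as data lets the intersection below range over one [Q]
   per index. *)
have Q_ex i : {Q | U Q & forall env env' : X -> A,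
    (forall x, Q (env x, env' x)) ->
    P i (eval env (args i), eval env' (args i))}.
  by apply: cid2; exact: IH (UP i).
exists [set xy | forall i, s2val (Q_ex i) xy].
  by apply: filter_forall => i; exact: s2valP.
move=> env env' Qenv; apply: (PR (_, _)) => i /=.
by apply: (s2valP' (Q_ex i)) => x; exact: Qenv.
Qed.

Lemma eval3_uniformly_continuous (S : signature) (A : algebra S)
    (U : set_system (A * A)) (hU : Unif A U) (p : term S 'I_3)
    (R : set (A * A)) (UR : U R) :
  exists2 Q, U Q & forall x x' y y' z z' : A,
    Q (x, x') -> Q (y, y') -> Q (z, z') ->
    R (eval3 p x y z, eval3 p x' y' z').
Proof.
have [Q UQ QR] := eval_uniformly_continuous _ _ _ hU _ p R UR.
exists Q => // x x' y y' z z' Qx Qy Qz; apply: QR.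
by case=> [[|[|[|i]]] ltn3] //; rewrite !(tnth_nth x).
Qed.

(** Filters are upward closed, so every filter containing [G'] also contains [G]. *)
Lemma Fg_sub (T : Type) (G G' : set_system (T * T)) :
  (forall R, G R -> exists2 R', G' R' & R' `<=` R) -> Fg G `<=` Fg G'.
Proof.
move=> refine R GR F [filterF G'F]; apply: GR; split=> // R1 /refine[R' G'R'].
by move=> /filterS; apply; exact: G'F.
Qed.

Lemma malcev_system_comp_sub (S : signature) (A : algebra S)
    (p : term S 'I_3)
    (hp : forall x y : A, eval3 p x x y = y /\ eval3 p y x x = y)
    (U V : set_system (A * A)) (hU : Unif A U) (hV : Unif A V) :
  Fg (system_comp U V) `<=` Fg (system_comp V U).
Proof.
have [[_ reflU _ _] _] := hU; have [[_ reflV _ _] _] := hV.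
apply: Fg_sub => _ [R UR [R' VR' <-]].
have [Q UQ QR] := eval3_uniformly_continuous _ _ _ hU p R UR.
have [Q' VQ' QR'] := eval3_uniformly_continuous _ _ _ hV p R' VR'.
(* Each comparison with the midpoint changes one argument of [p]: the last from [w] to [v], or the
   first from [u] to [w]. Reflexivity handles the other two. *)
have Qxx x : Q (x, x) by apply: (reflU Q UQ).
have Q'xx x : Q' (x, x) by apply: (reflV Q' VQ').
exists (rel_comp Q' Q); first by exists Q' => //; exists Q.
move=> [u v] [w /= Q'uw Qwv]; exists (eval3 p u w v) => /=.
  by rewrite -[u in R (u, _)](hp w u).2; exact: QR.
by rewrite -[v in R' (_, v)](hp w v).1; exact: QR'.
Qed.

Theorem theorem6p4 (S : signature) (K : algebra S -> Prop)
    (hK : is_malcev_variety K) (A : algebra S) (hA : K A)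
    (U V : set_system (A * A)) (hU : Unif A U) (hV : Unif A V) :
  permute U V.
Proof.
have [_ [p /(_ A hA) hp]] := hK.
(* The hypotheses on [U] and [V] are symmetric, so exchanging them gives the reverse inclusion. *)
by apply/seteqP; split; exact: (malcev_system_comp_sub _ _ _ hp).
Qed.
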